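(* Let $\mathbf{S}=\{A_1,\dots,A_m\}\subset\mathbb{S}^n$ and $b\in\mathbb{R}^m$. If $b\in SH(\mathbf{S})$, then there exists $X\in\mathbf{\Delta}_n$ with $p(X)=(A_1\bullet X,\dots,A_m\bullet X)^T=b$ such that $X$ can be written as a convex combination of $r$ rank-one matrices of the form $vv^T$, where $v\in\mathbb{R}^n$, $\Vert v\Vert=1$, with $$r\le\left\lfloor\frac{\sqrt{8m+9}-1}{2}\right\rfloor.$$
   Context: $\mathbb{S}^n$ is the space of real symmetric $n\times n$ matrices with inner product $X\bullet Y=\mathrm{Tr}(XY)$. The spectraplex is $\mathbf{\Delta}_n=\{X\in\mathbb{S}^n: \mathrm{Tr}(X)=1,\ X\succeq 0\}$ (with $X\succeq0$ meaning positive semidefinite). For $\mathbf{S}=\{A_1,\dots,A_m\}\subset\mathbb{S}^n$ and $X\in\mathbf{\Delta}_n$, $p(X)=(A_1\bullet X,\dots,A_m\bullet X)^T\in\mathbb{R}^m$; the spectrahull is $SH(\mathbf{S})=\{p(X): X\in\mathbf{\Delta}_n\}\subset\mathbb{R}^m$. $\lfloor\cdot\rfloor$ denotes the integer part and $\Vert\cdot\Vert$ the Euclidean norm. *)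

(* Defs.v *)
From HB Require Import structures.
From mathcomp Require Import all_boot all_order all_algebra.
From mathcomp Require Import sesquilinear.
From mathcomp Require Import classical_sets reals.

Set Implicit Arguments.
Unset Strict Implicit.
Unset Printing Implicit Defensive.

Import Order.TTheory GRing.Theory Num.Theory.

Local Open Scope classical_set_scope.
Local Open Scope ring_scope.

Definition mxinner (R : realType) (n : nat) (X Y : 'M[R]_n) : R :=
  \tr (X *m Y).

Definition psdmx (R : realType) (n : nat) (X : 'M[R]_n) : Prop :=
  X \is symmetricmx /\ forall u : 'cV[R]_n, 0 <= (u^T *m X *m u) 0 0.

Definition spectraplex (R : realType) (n : nat) : set 'M[R]_n :=
  [set X | \tr X = 1 /\ psdmx X].

Arguments spectraplex R n : clear implicits.

Definition spectramap (R : realType) (m n : nat) (A : 'I_m -> 'M[R]_n)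
    (X : 'M[R]_n) : 'cV[R]_m :=
  \col_i mxinner (A i) X.

Definition spectrahull (R : realType) (m n : nat) (A : 'I_m -> 'M[R]_n) :
    set 'cV[R]_m :=
  spectramap A @` spectraplex R n.

(* The library norm on matrices is the sup norm, hence this definition. *)
Definition l2norm (R : realType) (n : nat) (v : 'cV[R]_n) : R :=
  Num.sqrt (\sum_(i < n) v i 0 ^+ 2).

Definition convex_comb (R : realType) (V : lmodType R) (r : nat)
    (x : 'I_r -> V) (y : V) : Prop :=
  exists c : 'I_r -> R,
    [/\ forall k, 0 <= c k, \sum_(k < r) c k = 1 & y = \sum_(k < r) c k *: x k].

(* Main.v *)
(* Take a feasible X = V V^T with V of size n x r.  The matrices V (1 + t S) V^T,
   with S symmetric, satisfy the same m + 1 linear equations (trace included)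
   as soon as S is orthogonal to V^T V and to all the V^T A_i V; a nonzero such
   S exists when r (r + 1) / 2 > m + 1.  Moving along S (or - S) up to the
   boundary of the positive semidefinite cone makes 1 + t S = W W^T singular,
   so that V W has fewer columns.  Hence some feasible X has
   r (r + 1) / 2 <= m + 1, i.e. (2 r + 1)^2 <= 8 m + 9, and the normalized
   columns of V are the required unit vectors. *)
Require Import Defs.
From HB Require Import structures.
From mathcomp Require Import all_boot all_order all_algebra.
From mathcomp Require Import sesquilinear ring lra zify.
From mathcomp Require Import classical_sets reals boolp.

Set Implicit Arguments.
Unset Strict Implicit.
Unset Printing Implicit Defensive.

Import Order.TTheory GRing.Theory Num.Theory.

Local Open Scope classical_set_scope.
Local Open Scope ring_scope.

(** * Quadratic forms of symmetric matrices *)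

Lemma symmetricmxE (R : realType) (n : nat) (X : 'M[R]_n) :
  (X \is symmetricmx) = (X^T == X).
Proof. by rewrite is_hermitianmxE expr0 scale1r map_mx_id // eq_sym. Qed.

Definition quadform (R : realType) (n : nat) (X : 'M[R]_n) (u : 'cV[R]_n) : R :=
  (u^T *m X *m u) 0 0.

Section QuadraticForms.
Variables (R : realType) (n : nat).
Implicit Types (X Y : 'M[R]_n) (u w : 'cV[R]_n).

Lemma quadformD X Y u : quadform (X + Y) u = quadform X u + quadform Y u.
Proof. by rewrite /quadform mulmxDr mulmxDl mxE. Qed.

Lemma quadformZ (c : R) X u : quadform (c *: X) u = c * quadform X u.
Proof. by rewrite /quadform -scalemxAr -scalemxAl mxE. Qed.

Lemma quadform1 u : quadform 1%:M u = \sum_i u i 0 ^+ 2.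
Proof.
by rewrite /quadform mulmx1 mxE; apply: eq_bigr => i _; rewrite mxE expr2.
Qed.

Lemma quadform_congr (r : nat) (W : 'M[R]_(n, r)) (S : 'M[R]_r) u :
  quadform (W *m S *m W^T) u = quadform S (W^T *m u).
Proof. by rewrite /quadform trmx_mul trmxK !mulmxA. Qed.

Lemma bilin_delta X i j :
  ((delta_mx i 0 : 'cV_n)^T *m X *m (delta_mx j 0 : 'cV_n)) 0 0 = X i j.
Proof. by rewrite trmx_delta -rowE -colE !mxE. Qed.

Lemma quadform_addZ X u w (c : R) : X^T = X ->
  quadform X (u + c *: w) =
    quadform X u + c * (u^T *m X *m w) 0 0 *+ 2 + c ^+ 2 * quadform X w.
Proof.
move=> Xsym; have swap : (w^T *m X *m u) 0 0 = (u^T *m X *m w) 0 0.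
  have -> : w^T *m X *m u = (u^T *m X *m w)^T.
    by rewrite !trmx_mul Xsym trmxK mulmxA.
  by rewrite mxE.
rewrite /quadform.
have -> : (u + c *: w)^T = u^T + c *: w^T by rewrite linearD linearZ.
rewrite !mulmxDl !mulmxDr -!scalemxAl -!scalemxAr !mxE.
by move: swap; rewrite !mxE => ->; ring.
Qed.

Lemma psdmxP X : psdmx X <-> X^T = X /\ forall u, 0 <= quadform X u.
Proof. by rewrite /psdmx symmetricmxE; split=> -[/eqP]. Qed.

Lemma psdmx_diag0 X : psdmx X -> (forall i, X i i = 0) -> X = 0.
Proof.
move=> /psdmxP[Xsym Xpsd] Xdiag; apply/matrixP => i j; rewrite mxE.
(* With a zero diagonal, the form at [e_i - X i j *: e_j] equals [- 2 (X i j)^2]. *)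
have := Xpsd (delta_mx i 0 + (- X i j) *: delta_mx j 0).
rewrite quadform_addZ // /quadform !bilin_delta !Xdiag => h.
apply/eqP; rewrite -sqrf_eq0 eq_le sqr_ge0 andbT; nra.
Qed.

Lemma quadform_neq0 X : X^T = X -> X != 0 -> exists u, quadform X u != 0.
Proof.
move=> Xsym; apply: contraNP => /forallNP q0.
have {}q0 u : quadform X u = 0 by have /negP/negPn/eqP := q0 u.
apply/eqP/psdmx_diag0 => [|i]; last by rewrite -bilin_delta; apply: q0.
by apply/psdmxP; split=> // u; rewrite q0.
Qed.

End QuadraticForms.

(** * Schur complements and Gram factorization *)

Section PsdMatrices.
Variables (R : realType) (n : nat).
Implicit Types (X Y : 'M[R]_n) (u w : 'cV[R]_n).

Lemma psdmx_congr (r : nat) (W : 'M[R]_(n, r)) (S : 'M[R]_r) :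
  psdmx S -> psdmx (W *m S *m W^T).
Proof.
move=> /psdmxP[Ssym Spsd]; apply/psdmxP; split=> [|u].
  by rewrite !trmx_mul trmxK Ssym mulmxA.
by rewrite quadform_congr.
Qed.

Lemma psdmx1 : psdmx (1%:M : 'M[R]_n).
Proof.
apply/psdmxP; split=> [|u]; first exact: trmx1.
by rewrite quadform1 sumr_ge0 // => i _; rewrite sqr_ge0.
Qed.

(* At [u] the form of [Y] is that of [X] at [u - (s / X j j) e_j] with
   [s = u^T X e_j]; the rank drops because [Y] annihilates [e_j]. *)
Lemma psdmx_schur X j (Y := X - (X j j)^-1 *: (col j X *m (col j X)^T)) :
  psdmx X -> X j j != 0 -> [/\ 0 < X j j, psdmx Y & (\rank Y < \rank X)%N].
Proof.
move=> /psdmxP[Xsym Xpsd] Xjj.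
have Xjj_gt0 : 0 < X j j.
  by rewrite lt_neqAle eq_sym Xjj -bilin_delta; apply: Xpsd.
have Ye : Y *m delta_mx j (0 : 'I_1) = 0.
  rewrite mulmxBl -colE -scalemxAl -mulmxA.
  have -> : (col j X)^T *m delta_mx j (0 : 'I_1) = (X j j)%:M.
    by rewrite -colE; apply/matrixP => a b; rewrite !ord1 !mxE.
  by rewrite mul_mx_scalar scalerA mulVf // scale1r subrr.
split=> //.
  apply/psdmxP; split=> [|u].
    by rewrite /Y linearB linearZ /= trmx_mul trmxK Xsym.
  set s := (u^T *m X *m (delta_mx j 0 : 'cV_n)) 0 0.
  have qs : quadform (col j X *m (col j X)^T) u = s ^+ 2.
    rewrite -[X in X *m _]mulmx1 quadform_congr quadform1 big_ord1 /s.
    have -> : (col j X)^T *m u = (u^T *m X *m delta_mx j (0 : 'I_1))^T.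
      by rewrite colE !trmx_mul trmxK mulmxA.
    by rewrite mxE.
  rewrite /Y -scaleNr quadformD quadformZ qs.
  have := Xpsd (u + (- (s / X j j)) *: delta_mx j 0).
  have qe : quadform X (delta_mx j 0) = X j j by rewrite -bilin_delta.
  rewrite quadform_addZ // -/s qe -addrA.
  suff -> : - (s / X j j) * s *+ 2 + (- (s / X j j)) ^+ 2 * X j j
            = - (X j j)^-1 * s ^+ 2 by [].
  by field.
have YX : (Y <= X)%MS.
  rewrite addmx_sub ?eqmx_opp ?scalemx_sub // mulmx_sub //.
  by rewrite tr_col Xsym row_sub.
(* Equal ranks would give [X = D *m Y], so [X] would annihilate [e_j] too, against [X j j != 0]. *)
rewrite ltn_neqAle mxrankS // andbT; apply/negP => /eqP eqrk.
have : (X <= Y)%MS by rewrite -(mxrank_leqif_sup YX).2 eqrk.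
case/submxP => D XD; move/eqP: Xjj; apply.
have -> : X j j = (X *m delta_mx j (0 : 'I_1)) j 0 by rewrite -colE mxE.
by rewrite XD -mulmxA Ye mulmx0 mxE.
Qed.

End PsdMatrices.

(** Column-by-column Cholesky: each nonzero pivot splits off one column of [W], and the Schur
    complement has smaller rank. With no pivot left, the matrix is zero by [psdmx_diag0]. *)
Lemma psdmx_factor (R : realType) (n k : nat) (X : 'M[R]_n) :
  psdmx X -> (\rank X <= k)%N -> exists W : 'M[R]_(n, k), X = W *m W^T.
Proof.
elim: k X => [|k IHk] X Xpsd rkX.
  exists 0; rewrite mul0mx; apply/eqP.
  by rewrite -mxrank_eq0 -leqn0.
have [[j Xjj]|/forallNP X0] := pselect (exists j, X j j != 0); last first.
  exists 0; rewrite mul0mx; apply: psdmx_diag0 => // i.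
  by have /negP/negPn/eqP := X0 i.
have [Xjj_gt0 Ypsd rkY] := psdmx_schur Xpsd Xjj.
have [W YW] := IHk _ Ypsd (leq_trans rkY rkX).
suff [V XV] : exists V : 'M[R]_(n, 1 + k), X = V *m V^T by exists V.
exists (row_mx (Num.sqrt (X j j)^-1 *: col j X) W).
rewrite tr_row_mx mul_row_col -YW linearZ /= -scalemxAl -scalemxAr scalerA.
by rewrite -expr2 sqr_sqrtr ?invr_ge0 ?ltW // addrC subrK.
Qed.

(** * Moving inside the semidefinite cone up to its boundary *)

Lemma psdmx_near1 (R : realType) (r : nat) (S : 'M[R]_r) :
  S^T = S -> exists2 e : R, 0 < e & psdmx (1%:M + e *: S).
Proof.
(* Since [|u_i| |u_j| <= |u|^2], the form of [S] is at least [- C |u|^2]. The step is [1 / (1 + C)]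
   rather than [1 / C] because [C] vanishes when [S = 0]. *)
move=> Ssym; pose C := \sum_i \sum_j `|S i j|.
have C_ge0 : 0 <= C by do 2!apply: sumr_ge0 => ? _.
have C1_gt0 : 0 < 1 + C by rewrite ltr_pwDl.
exists (1 + C)^-1; first by rewrite invr_gt0.
apply/psdmxP; split=> [|u]; first by rewrite linearD linearZ /= trmx1 Ssym.
set N := quadform 1%:M u.
have N_ge0 : 0 <= N by have /psdmxP[_] := psdmx1 R r; apply.
have u2_le i : u i 0 ^+ 2 <= N.
  rewrite /N quadform1 (bigD1 i) //= lerDl sumr_ge0 // => j _.
  exact: sqr_ge0.
have SN : - (C * N) <= quadform S u.
  rewrite lerNl -[- _]mulN1r -quadformZ scaleN1r /quadform mxE.
  under eq_bigr do rewrite mxE mulr_suml.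
  rewrite exchange_big mulr_suml ler_sum //= => i _.
  rewrite mulr_suml ler_sum //= => j _; rewrite !mxE.
  apply: le_trans (ler_norm _) _.
  rewrite !normrM normrN mulrAC mulrC ler_wpM2l //.
  have normsq (x : R) : x ^+ 2 = `|x| ^+ 2 by rewrite real_normK ?num_real.
  have := u2_le i; have := u2_le j; rewrite (normsq (u i 0)) (normsq (u j 0)).
  move: `|u i 0| `|u j 0| => a b; rewrite !expr2 => bN aN.
  have := sqr_ge0 (a - b); rewrite sqrrB !expr2; lra.
rewrite quadformD quadformZ -/N.
rewrite -(pmulr_rge0 _ C1_gt0) mulrDr mulrA divff ?gt_eqF // mul1r.
by rewrite mulrDl mul1r; lra.
Qed.

(** Write [M = W *m W^T] with [W] invertible; congruence by the inverse of [W] reduces to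
    [M = 1]. *)
Lemma psdmx_near_full (R : realType) (r : nat) (M S : 'M[R]_r) :
  psdmx M -> \rank M = r -> S^T = S ->
  exists2 e : R, 0 < e & psdmx (M + e *: S).
Proof.
move=> Mpsd rkM Ssym.
have [W MW] : exists W : 'M_r, M = W *m W^T.
  by apply: psdmx_factor; rewrite ?rkM.
have Wunit : W \in unitmx.
  rewrite -row_full_unit -col_leq_rank -{1}rkM MW.
  by rewrite mxrankM_maxl.
have [|e e_gt0 epsd] := @psdmx_near1 R r (invmx W *m S *m (invmx W)^T).
  by rewrite !trmx_mul trmxK Ssym mulmxA.
exists e => //; have := psdmx_congr W epsd.
rewrite mulmxDr mulmx1 mulmxDl -MW -scalemxAr -scalemxAl !mulmxA.
by rewrite mulmxV // mul1mx -mulmxA -trmx_mul mulmxV // trmx1 mulmx1.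
Qed.

(* The largest [t] for which [1 + t S] is positive semidefinite works: at full
   rank, [psdmx_near_full] would allow a larger one. *)
Lemma psdmx_boundary (R : realType) (r : nat) (S : 'M[R]_r) (u : 'cV[R]_r) :
  S^T = S -> quadform S u < 0 ->
  exists2 t : R, psdmx (1%:M + t *: S) & (\rank (1%:M + t *: S)%R < r)%N.
Proof.
move=> Ssym Su; pose T := [set t : R | psdmx (1%:M + t *: S)].
have T0 : T !=set0 by exists 0; rewrite /T /= scale0r addr0; apply: psdmx1.
have Tub w : quadform S w < 0 ->
    ubound T (- (quadform 1%:M w / quadform S w)).
  move=> Sw t /psdmxP[_ /(_ w)]; rewrite quadformD quadformZ => h.
  by rewrite -mulrN -invrN ler_pdivlMr ?oppr_gt0 // mulrN; lra.
have supT : ubound T (sup T).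
  by apply: ub_le_sup; exact: (ex_intro _ _ (Tub u Su)).
(* The supremum is attained: at [w] with negative form of [S], [sup T] obeys the bound [Tub]; at any
   other [w], [0 <= sup T] suffices. *)
have Tsup : psdmx (1%:M + sup T *: S).
  apply/psdmxP; split=> [|w]; first by rewrite linearD linearZ /= trmx1 Ssym.
  rewrite quadformD quadformZ.
  have w_ge0 : 0 <= quadform 1%:M w by have /psdmxP[_] := psdmx1 R r; apply.
  have [Sw|Sw] := leP 0 (quadform S w).
    rewrite addr_ge0 // mulr_ge0 //; apply: supT.
    by rewrite /T /= scale0r addr0; apply: psdmx1.
  have := ge_sup T0 (Tub w Sw).
  by rewrite -mulrN -invrN ler_pdivlMr ?oppr_gt0 // mulrN; lra.
exists (sup T) => //; rewrite ltn_neqAle rank_leq_row andbT.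
apply/negP => /eqP rk_full.
have [e e_gt0] := psdmx_near_full Tsup rk_full Ssym.
rewrite -addrA -scalerDl => /supT; lra.
Qed.

(** * Dimension count for trace-orthogonal symmetric matrices *)

Lemma exists_trace_orthogonal (F : fieldType) (r : nat) (I : finType)
    (G : I -> 'M[F]_r) : (#|I| < r * r)%N ->
  exists2 S : 'M[F]_r, S != 0 & forall i, \tr (G i *m S) = 0.
Proof.
move=> ltI.
(* The rows of [N] are indexed by matrix entries and its columns by the equations; more rows than
   columns leave a nonzero left kernel vector. *)
pose N := \matrix_(a < r * r, k < #|I|)
  \tr (G (enum_val k) *m vec_mx (delta_mx 0 a)).
have : kermx N != 0.
  by rewrite kermx_eq0 -row_leq_rank -ltnNge (leq_ltn_trans (rank_leq_col N)).
case/rowV0Pn => x /sub_kermxP xN x0.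
exists (vec_mx x) => [|i].
  by apply: contraNneq x0 => x0; rewrite -[x]vec_mxK x0 linear0.
have /rowP/(_ (enum_rank i)) := xN; rewrite !mxE => <-.
rewrite [in LHS](row_sum_delta x) !linear_sum /=; apply: eq_bigr => a _.
by rewrite !mxE enum_rankK linearZ /= -scalemxAr mxtraceZ.
Qed.

Lemma card_ord_gt_pairs (r : nat) :
  #|[pred p : 'I_r * 'I_r | (p.2 < p.1)%N]| = 'C(r, 2).
Proof.
rewrite -bin2_sum big_mkord -sum1_card.
transitivity (\sum_(i < r) \sum_(j < r | (j < i)%N) 1)%N.
  by rewrite pair_big_dep.
apply: eq_bigr => i _.
rewrite -(big_ord_widen _ (fun=> 1%N) (ltnW (ltn_ord i))).
by rewrite big_const_ord iter_addn_0 mul1n.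
Qed.

Lemma bin2_add_consecutive (r : nat) : ('C(r, 2) + 'C(r.+1, 2) = r * r)%N.
Proof.
elim: r => // r IHr; have := binS r 1; have := binS r.+1 1.
by rewrite !bin1 mulSn mulnS; lia.
Qed.

(** Symmetry is itself a family of trace equations, against [E_ij - E_ji] for [j < i]. These
    ['C(r, 2)] equations and those of [G] together number fewer than [r * r]. *)
Lemma exists_symmetric_trace_orthogonal (F : fieldType) (r : nat) (I : finType)
    (G : I -> 'M[F]_r) : (#|I| < 'C(r.+1, 2))%N ->
  exists S : 'M[F]_r, [/\ S != 0, S^T = S & forall i, \tr (G i *m S) = 0].
Proof.
move=> ltI; pose P := {p : 'I_r * 'I_r | (p.2 < p.1)%N}.
pose H (a : P + I) : 'M[F]_r := match a with
  | inl p => delta_mx (val p).1 (val p).2 - delta_mx (val p).2 (val p).1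
  | inr i => G i
  end.
have tr_delta (i j : 'I_r) (S : 'M[F]_r) : \tr (delta_mx i j *m S) = S j i.
  rewrite -(mul_delta_mx (0 : 'I_1)) -mulmxA mxtrace_mulC -rowE trace_mx11.
  by rewrite -colE !mxE.
have [|S S0 HS] := @exists_trace_orthogonal F r _ H.
  rewrite card_sum card_sig card_ord_gt_pairs.
  rewrite -bin2_add_consecutive.
  by rewrite ltn_add2l.
exists S; split=> // [|i]; last exact: (HS (inr i)).
have lower (i j : 'I_r) : (j < i)%N -> S j i = S i j.
  move=> ji; have := HS (inl (exist _ (i, j) ji)).
  by rewrite /= mulmxBl linearB /= !tr_delta => /eqP; rewrite subr_eq0 => /eqP.
apply/matrixP => i j; rewrite mxE.
by have [/lower //|/lower //|/val_inj -> //] := ltngtP i j.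
Qed.

(** * Reducing the number of columns *)

Lemma reduce_gram_factor (R : realType) (n r : nat) (I : finType)
    (B : I -> 'M[R]_n) (V : 'M[R]_(n, r)) : (#|I| < 'C(r.+1, 2))%N ->
  exists (r' : nat) (V' : 'M[R]_(n, r')), (r' < r)%N /\
    forall i, \tr (B i *m (V' *m V'^T)) = \tr (B i *m (V *m V^T)).
Proof.
move=> ltI.
have [S [S0 Ssym HS]] :=
  exists_symmetric_trace_orthogonal (fun i => V^T *m B i *m V) ltI.
(* A nonzero symmetric [S] has a nonzero form somewhere; [S] or [- S] makes it negative, and both
   satisfy the equations. *)
wlog [u Su] : S S0 Ssym HS / exists u, quadform S u < 0 => [hwlog|].
  have [u] := quadform_neq0 Ssym S0.
  have [Su _|Su _|_ //] := ltgtP (quadform S u) 0.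
    by apply: (hwlog S) => //; exists u.
  apply: (hwlog (- S)); rewrite ?oppr_eq0 ?linearN /= ?Ssym //.
    by move=> i; rewrite mulmxN linearN /= HS oppr0.
  by exists u; rewrite -scaleN1r quadformZ mulN1r oppr_lt0.
have [t Mpsd rkM] := psdmx_boundary Ssym Su.
(* The predecessor is genuine: a rank below [r] forces [0 < r]. *)
have [|W MW] := psdmx_factor (k := r.-1) Mpsd.
  by rewrite -ltnS prednK // (leq_ltn_trans _ rkM).
exists r.-1, (V *m W); split=> [|i].
  by rewrite prednK // (leq_ltn_trans _ rkM).
have -> : V *m W *m (V *m W)^T = V *m V^T + t *: (V *m S *m V^T).
  rewrite trmx_mul -mulmxA (mulmxA W) -MW mulmxDl mul1mx mulmxDr.
  by rewrite -scalemxAl -scalemxAr mulmxA.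
rewrite mulmxDr mxtraceD -scalemxAr mxtraceZ.
have -> : \tr (B i *m (V *m S *m V^T)) = \tr (V^T *m B i *m V *m S).
  by rewrite mulmxA mxtrace_mulC !mulmxA.
by rewrite HS mulr0 addr0.
Qed.

Lemma small_gram_factor (R : realType) (n r : nat) (I : finType)
    (B : I -> 'M[R]_n) (V : 'M[R]_(n, r)) :
  exists (r' : nat) (V' : 'M[R]_(n, r')), ('C(r'.+1, 2) <= #|I|)%N /\
    forall i, \tr (B i *m (V' *m V'^T)) = \tr (B i *m (V *m V^T)).
Proof.
have [k] := ubnP r; elim: k r V => // k IHk r V /ltnSE-rk.
have [small|/(reduce_gram_factor B V)[r1 [V1 [r1r V1E]]]] :=
  leqP 'C(r.+1, 2) #|I|.
  by exists r, V.
have [r' [V' [small V'E]]] := IHk _ V1 (leq_trans r1r rk).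
by exists r', V'; split=> // i; rewrite V'E.
Qed.

(** * The numerical bound and the convex combination *)

Lemma le_floor_of_bin2 (R : realType) (m r : nat) : ('C(r.+1, 2) <= m.+1)%N ->
  r%:Z <= Num.floor ((Num.sqrt (8 * m + 9)%:R - 1) / 2 : R).
Proof.
move=> small; rewrite floor_ge_int ler_pdivlMr // lerBrDr.
(* Here [2 'C(r.+1, 2) = r (r + 1)], so [(2 r + 1)^2 = 8 'C(r.+1, 2) + 1]. *)
have le_sqr : ((2 * r + 1) ^ 2 <= 8 * m + 9)%N.
  have := bin2_add_consecutive r; have := binS r 1; rewrite bin1; nia.
have -> : r%:~R * 2 + 1 = (2 * r + 1)%N%:R :> R by rewrite natrD natrM mulrC.
by rewrite -[leLHS]ger0_norm ?ler0n // -sqrtr_sqr ler_wsqrtr // -natrX ler_nat.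
Qed.

Lemma gramE (R : comPzRingType) (n r : nat) (V : 'M[R]_(n, r)) :
  V *m V^T = \sum_k col k V *m (col k V)^T.
Proof.
apply/matrixP => i j; rewrite summxE !mxE; apply: eq_bigr => k _.
by rewrite !mxE big_ord1 !mxE.
Qed.

Lemma l2norm_sqr (R : realType) (n : nat) (v : 'cV[R]_n) :
  l2norm v ^+ 2 = \tr (v *m v^T).
Proof.
rewrite /l2norm sqr_sqrtr ?sumr_ge0 // => [|i _]; last exact: sqr_ge0.
by apply: eq_bigr => i _; rewrite !mxE big_ord1 !mxE expr2.
Qed.

Lemma l2normZ (R : realType) (n : nat) (c : R) (v : 'cV[R]_n) :
  0 <= c -> l2norm (c *: v) = c * l2norm v.
Proof.
move=> c0; rewrite /l2norm.
under eq_bigr do rewrite mxE exprMn.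
by rewrite -mulr_sumr sqrtrM ?sqr_ge0 // sqrtr_sqr ger0_norm.
Qed.

(** The trace is the squared norm of [v]. For [v = 0] any unit vector serves, and the dimension
    [n.+1] ensures that one exists. *)
Lemma unit_vector_dyad (R : realType) (n : nat) (v : 'cV[R]_n.+1) :
  exists u : 'cV[R]_n.+1, l2norm u = 1 /\
    v *m v^T = \tr (v *m v^T) *: (u *m u^T).
Proof.
have l2norm_ge0 : 0 <= l2norm v by apply: sqrtr_ge0.
have [v0|vn0] := eqVneq (l2norm v) 0.
  exists (delta_mx 0 0); split.
    rewrite /l2norm (bigD1 0) //= big1 => [|i /negPf i0]; rewrite !mxE.
      by rewrite eqxx expr1n addr0 sqrtr1.
    by rewrite i0 expr0n.
  have vz : v = 0.
    apply/colP => i; rewrite mxE; apply/eqP; rewrite -sqrf_eq0; apply/eqP.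
    move: v0; rewrite /l2norm => /eqP; rewrite sqrtr_eq0 => le0.
    have sum0 : \sum_i v i 0 ^+ 2 = 0.
      by apply/eqP; rewrite eq_le le0 sumr_ge0 // => j _; apply: sqr_ge0.
    by apply: (psumr_eq0P _ sum0) => // j _; apply: sqr_ge0.
  by rewrite vz mul0mx linear0 scale0r.
exists ((l2norm v)^-1 *: v); split.
  by rewrite l2normZ ?invr_ge0 // mulVf.
rewrite linearZ /= -scalemxAl -scalemxAr !scalerA -l2norm_sqr.
by rewrite -mulrA -expr2 exprVn divff ?scale1r // sqrf_eq0.
Qed.

Theorem theorem12 (R : realType) (m n : nat) (A : 'I_m -> 'M[R]_n)
    (b : 'cV[R]_m) :
  (forall i, A i \is symmetricmx) ->
  spectrahull A b ->
  exists2 X : 'M[R]_n, spectraplex R n X /\ spectramap A X = b &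
    exists (r : nat) (v : 'I_r -> 'cV[R]_n),
      [/\ r%:Z <= Num.floor ((Num.sqrt (8 * m + 9)%:R - 1) / 2 : R),
          forall k, l2norm (v k) = 1
        & convex_comb (fun k => v k *m (v k)^T) X].
Proof.
move=> _ [X0 [trX0 X0psd] <-] {b}.
(* In dimension 0 every trace is 0, so the spectraplex is empty. *)
case: n A X0 trX0 X0psd => [A X0|n A X0 trX0 X0psd].
  by rewrite /mxtrace big_ord0 => /esym/eqP; rewrite oner_eq0.
have [V0 X0V] := psdmx_factor X0psd (leqnn _).
(* The index [None] carries the trace condition, making [m + 1] equations in all. *)
pose B (i : option 'I_m) := if i is Some i then A i else 1%:M.
have [r [V [small VE]]] := small_gram_factor B V0.
rewrite card_option card_ord in small.
have trV : \tr (V *m V^T) = 1.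
  by have := VE None; rewrite /= !mul1mx -X0V trX0.
exists (V *m V^T); first split.
- split=> //; have := psdmx_congr V (psdmx1 R r); by rewrite mulmx1.
- by apply/colP => i; rewrite !mxE /mxinner (VE (Some i)) -X0V.
have [u uP] := fin_all_exists (fun k => unit_vector_dyad (col k V)).
exists r, u; split=> [|k|]; first exact: le_floor_of_bin2.
  by have [] := uP k.
(* The weights are the squared norms of the columns of [V]; they sum to the trace of [V *m V^T],
   which is 1. *)
exists (fun k => \tr (col k V *m (col k V)^T)); split=> [k||].
- by rewrite -l2norm_sqr sqr_ge0.
- by rewrite -trV gramE linear_sum.
- by rewrite gramE; apply: eq_bigr => k _; have [] := uP k.
Qed.
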